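(* For every integer $k\ge 1$, the polynomial $P_k\!\left(x+k-\tfrac{3}{2}\right)$ has positive coefficients in $x$; that is, if $d$ is its degree, then the coefficient of $x^m$ is positive for every $0\le m\le d$.
   Context: The polynomials $P_k(x)$, $k\ge 1$, are defined recursively by $P_1(x)=1$ and, for $k\ge 1$, $$P_{k+1}(x) = \frac{P_k(k)\prod_{i=1}^{k}(2x-2k+2i+1)-\left(\prod_{i=1}^{k}(2i+1)\right)P_k(x)}{2x-2k};$$ this is a polynomial because the numerator vanishes at $x=k$ (the quotient is taken as polynomials in $x$). *)

(* Defs.v *)
From mathcomp Require Import all_boot all_order all_algebra.

Set Implicit Arguments.
Unset Strict Implicit.
Unset Printing Implicit Defensive.

Import Order.TTheory GRing.Theory Num.Theory.
Local Open Scope ring_scope.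

Definition Pnum (k : nat) (p : {poly rat}) : {poly rat} :=
  p.[k%:R] *: \prod_(1 <= i < k.+1)
                (2%:R *: 'X - ((2 * k)%:R)%:P + ((2 * i + 1)%:R)%:P)
  - (\prod_(1 <= i < k.+1) (2 * i + 1)%:R) *: p.

Definition Pden (k : nat) : {poly rat} := 2%:R *: 'X - ((2 * k)%:R)%:P.

(* The sequence starts at index 1; [P 0] is a dummy value, never used.
   The division [%/] is exact, see [P_rec]. *)
Fixpoint P (k : nat) : {poly rat} :=
  match k with
  | 0 => 0
  | k'.+1 => if k' == 0%N then 1 else Pnum k' (P k') %/ Pden k'
  end.

Lemma P_1 : P 1 = 1.
Proof. by []. Qed.

Lemma Pden_dvd (k : nat) (p : {poly rat}) : Pden k %| Pnum k p.
Proof.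
have -> : Pden k = 2%:R *: ('X - (k%:R)%:P).
  by rewrite /Pden scalerBr natrM polyCM mul_polyC.
rewrite dvdpZl // dvdp_XsubCl /root /Pnum !hornerE horner_prod.
rewrite (eq_bigr (fun i : nat => (2 * i + 1)%:R)) => [|i _]; last first.
  by rewrite !hornerE natrM subrr add0r.
by rewrite mulrC subrr.
Qed.

Lemma P_rec (k : nat) : (1 <= k)%N -> P k.+1 * Pden k = Pnum k (P k).
Proof. by case: k => // k _; apply/divpK/Pden_dvd. Qed.

(* Main.v *)
Require Import Defs.
From mathcomp Require Import all_boot all_order all_algebra.
From mathcomp Require Import ring.

(** Put [Q_k(x) = P_k(x + k - 3/2)], [a_i = 2x + 2i], [b_i = 2i + 1]
    and [ell = 2x - 1].  Then [a_i - b_i = ell] for all [i], and the recursion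
    reads ([Q_rec])
      [ell Q_(k+1)(x) = Q_k(3/2) a_1 ... a_k - b_1 ... b_k Q_k(x + 1)],
    and its right-hand side is linear in [Q_k].  It is well behaved on the tail
    products [E_(k,j) = a_(j+1) ... a_(k-1)], [j < k].  The shift by 1 turns
    [a_i] into [a_(i+1)], and evaluation at 3/2 turns it into [b_(i+1)], so for
    [Q_k = E_(k,j)] the right-hand side is
      [b_(j+2) ... b_k (a_1 ... a_k - b_1 ... b_(j+1) a_(j+2) ... a_k)].
    Replacing the [a_i] by the [b_i] one at a time, the difference telescopes
    into [ell] times a combination of [E_(k+1,1), ..., E_(k+1,j+1)] with
    positive coefficients ([telescope_cone]).  Hence the recursion maps the
    convex cone generated by the [E_(k,j)] into the cone generated by the
    [E_(k+1,j)] ([step_cone]).  As [Q_1 = 1 = E_(1,0)], each [Q_k] is in its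
    cone ([Q_cone]); and the elements of the cones have positive coefficients,
    because this property is stable under sums, positive scalings and products
    with the [a_i] ([cone_pos]). *)

Set Implicit Arguments.
Unset Strict Implicit.
Unset Printing Implicit Defensive.

Import Order.TTheory GRing.Theory Num.Theory.
Local Open Scope ring_scope.

Definition poscoef (p : {poly rat}) : Prop :=
  p != 0 /\ forall m, (m < size p)%N -> 0 < p`_m.

Lemma poscoef_ge0 p m : poscoef p -> 0 <= p`_m.
Proof.
case=> _ p_gt0; case: (ltnP m (size p)) => [/p_gt0/ltW //|le_p_m].
by rewrite nth_default.
Qed.

Lemma poscoef0 p : poscoef p -> 0 < p`_0.
Proof. by case=> p_neq0; apply; rewrite size_poly_gt0. Qed.

Lemma coef0_gt0_neq0 (p : {poly rat}) : 0 < p`_0 -> p != 0.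
Proof. by apply: contraTneq => ->; rewrite coef0 ltxx. Qed.

Lemma poscoefD p q : poscoef p -> poscoef q -> poscoef (p + q).
Proof.
move=> p_pos q_pos; split.
  by apply: coef0_gt0_neq0; rewrite coefD addr_gt0 ?poscoef0.
move=> m /leq_trans/(_ (size_polyD p q)); rewrite coefD leq_max.
case/orP=> [/p_pos.2|/q_pos.2] lt0.
- exact: ltr_wpDr (poscoef_ge0 m q_pos) lt0.
- exact: ltr_wpDl (poscoef_ge0 m p_pos) lt0.
Qed.

Lemma poscoefZ (c : rat) p : 0 < c -> poscoef p -> poscoef (c *: p).
Proof.
move=> c_gt0 [p_neq0 p_gt0]; split; first by rewrite scaler_eq0 negb_or gt_eqF.
by move=> m; rewrite size_scale ?gt_eqF // coefZ => /p_gt0; apply: mulr_gt0.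
Qed.

Lemma poscoefM_linear (c d : rat) p :
  0 < c -> 0 < d -> poscoef p -> poscoef (p * (c *: 'X + d%:P)).
Proof.
move=> c_gt0 d_gt0 p_pos.
have coefE m : (p * (c *: 'X + d%:P))`_m
    = c * (if m == 0%N then 0 else p`_m.-1) + p`_m * d.
  by rewrite mulrDr coefD -scalerAr coefZ coefMX coefMC.
split.
  by apply: coef0_gt0_neq0; rewrite coefE mulr0 add0r mulr_gt0 ?poscoef0.
move=> m lt_m; rewrite coefE.
case: m lt_m => [|m] lt_m; first by rewrite mulr0 add0r mulr_gt0 ?poscoef0.
have le_size : (size (c *: 'X + d%:P)%R <= 2)%N.
  rewrite (leq_trans (size_polyD _ _)) // geq_max.
  rewrite (leq_trans (size_scale_leq _ _)) ?size_polyX //.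
  exact: leq_trans (size_polyC_leq1 _) _.
have lt_m_p : (m < size p)%N.
  have le_sum : ((size p + size (c *: 'X + d%:P)%R).-1 <= (size p).+1)%N.
    by rewrite -subn1 leq_subLR add1n -addn2 leq_add2l.
  exact: leq_trans lt_m (leq_trans (size_polyMleq _ _) le_sum).
apply: ltr_wpDr; first exact: mulr_ge0 (poscoef_ge0 _ p_pos) (ltW d_gt0).
exact: mulr_gt0 c_gt0 (p_pos.2 _ lt_m_p).
Qed.

Definition a (i : nat) : {poly rat} := 2%:R *: 'X + ((2 * i)%:R)%:P.

Definition b (i : nat) : rat := (2 * i + 1)%:R.

Definition E (k j : nat) : {poly rat} := \prod_(j.+1 <= i < k) a i.

Definition ell : {poly rat} := 2%:R *: 'X - 1.

Lemma subab i : a i - (b i)%:P = ell.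
Proof. by rewrite /a /b /ell natrD polyCD opprD addrA addrK. Qed.

Lemma b_gt0 i : 0 < b i.
Proof. by rewrite ltr0n addn1. Qed.

Lemma prod_b_gt0 m n : 0 < \prod_(m <= i < n) b i.
Proof. by apply: prodr_gt0 => i _; apply: b_gt0. Qed.

Lemma E_poscoef k j : poscoef (E k j).
Proof.
have pos1 : poscoef 1.
  split=> [|m]; first exact: oner_neq0.
  by rewrite size_poly1 ltnS leqn0 => /eqP->; rewrite coef1.
elim: k => [|k IHk]; first by rewrite /E big_geq.
rewrite /E; case: (ltnP j k) => [lt_jk|le_kj]; last by rewrite big_geq.
rewrite big_nat_recr //=; apply: poscoefM_linear IHk; first by [].
by rewrite ltr0n muln_gt0 (leq_ltn_trans _ lt_jk).
Qed.

(** Generating the cone inductively, with strictly positive factors only,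
    keeps 0 out of it, so its elements have genuinely positive coefficients. *)
Inductive cone (k : nat) : {poly rat} -> Prop :=
| cone_gen j : (j < k)%N -> cone k (E k j)
| cone_scale c p : 0 < c -> cone k p -> cone k (c *: p)
| cone_add p q : cone k p -> cone k q -> cone k (p + q).

Lemma cone_pos k p : cone k p -> poscoef p.
Proof.
elim=> [j _|c q c_gt0 _|q r _ ? _].
- exact: E_poscoef.
- exact: poscoefZ.
- exact: poscoefD.
Qed.

(** Changing the factor [a_n] into [b_n] in a product costs
    [a_n - b_n = ell] times the other factors, which are constants [b_i]
    for [i < n] and the tail [E_(k+1,n)] for [i > n]. *)
Lemma telescope_cone k n : (n < k)%N ->
  exists2 q, cone k.+1 q &
    ell * q
      = \prod_(1 <= i < k.+1) a i - (\prod_(1 <= i < n.+2) b i) *: E k.+1 n.+1.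
Proof.
elim: n => [|n IHn] lt_nk.
  exists (E k.+1 1); first by apply: cone_gen.
  rewrite big_nat1 -(subab 1) mulrBl mul_polyC; congr (_ - _).
  by rewrite [in RHS]big_ltn.
have [q q_cone q_eq] := IHn (ltnW lt_nk).
exists (q + (\prod_(1 <= i < n.+2) b i) *: E k.+1 n.+2).
  by apply: cone_add q_cone (cone_scale (prod_b_gt0 _ _) (cone_gen _)).
have E_n : E k.+1 n.+1 = a n.+2 * E k.+1 n.+2 by rewrite /E big_ltn.
rewrite mulrDr q_eq E_n -scalerAr -(subab n.+2) mulrBl mul_polyC scalerBr scalerA.
rewrite [\prod_(1 <= i < n.+3) b i]big_nat_recr //=.
by rewrite addrA addrNK.
Qed.

Lemma E_shift k j : E k j \Po ('X + 1) = E k.+1 j.+1.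
Proof.
rewrite /E rmorph_prod [RHS]big_add1 /=; apply: eq_bigr => i _.
rewrite /a comp_polyD comp_polyZ comp_polyX comp_polyC scalerDr -addrA.
by rewrite mulnS natrD polyCD alg_polyC.
Qed.

Lemma E_horner k j : (E k j).[3%:R / 2%:R] = \prod_(j.+2 <= i < k.+1) b i.
Proof.
rewrite /E horner_prod [RHS]big_add1 /=; apply: eq_bigr => i _.
by rewrite /a /b hornerD hornerZ hornerX hornerC mulnS !natrD; field.
Qed.

(** Both the evaluation at 3/2 and the shift are linear, so it is enough to
    treat [E_(k,j)]; there, [b_(j+2) ... b_k] is a common factor. *)
Lemma step_cone k p : cone k p ->
  exists2 q, cone k.+1 q &
    ell * q
      = p.[3%:R / 2%:R] *: \prod_(1 <= i < k.+1) a i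
        - (\prod_(1 <= i < k.+1) b i) *: (p \Po ('X + 1)).
Proof.
elim=> {p} [j lt_jk|c p c_gt0 _ [q q_cone q_eq]|p1 p2 _ [q1 c1 e1] _ [q2 c2 e2]].
- have [q q_cone q_eq] := telescope_cone lt_jk.
  exists ((\prod_(j.+2 <= i < k.+1) b i) *: q).
    exact: cone_scale (prod_b_gt0 _ _) q_cone.
  rewrite -scalerAr q_eq scalerBr scalerA E_horner E_shift; congr (_ - _ *: _).
  by rewrite mulrC -big_cat_nat.
- exists (c *: q); first exact: cone_scale.
  rewrite -scalerAr q_eq scalerBr hornerZ comp_polyZ !scalerA.
  by rewrite [c * \prod_(_ <= _ < _) _]mulrC.
- exists (q1 + q2); first exact: cone_add.
  rewrite mulrDr e1 e2 hornerD comp_polyD scalerDl scalerDr opprD.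
  by rewrite addrACA.
Qed.

Definition Q (k : nat) : {poly rat} := P k \Po ('X + (k%:R - 3%:R / 2%:R)%:P).

Lemma Q_shift k : Q k \Po ('X + 1) = P k \Po ('X + (k.+1%:R - 3%:R / 2%:R)%:P).
Proof.
rewrite /Q -comp_polyA comp_polyD comp_polyX comp_polyC; congr (_ \Po _).
by rewrite -addrA -polyC1 -polyCD; congr (_ + _%:P); rewrite -natr1; ring.
Qed.

Lemma Q_horner k : (Q k).[3%:R / 2%:R] = (P k).[k%:R].
Proof. by rewrite /Q horner_comp hornerD hornerX hornerC addrC subrK. Qed.

Lemma Q_rec k : (1 <= k)%N ->
  ell * Q k.+1
    = (Q k).[3%:R / 2%:R] *: \prod_(1 <= i < k.+1) a i
      - (\prod_(1 <= i < k.+1) b i) *: (Q k \Po ('X + 1)).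
Proof.
move=> k_gt0; rewrite Q_shift Q_horner.
set L := 'X + _.
have den_L : Pden k \Po L = ell.
  rewrite /Pden /ell comp_polyB comp_polyZ comp_polyX comp_polyC /L scalerDr -addrA.
  congr (_ + _); rewrite -mul_polyC -polyCM -polyCB -polyC1 -polyCN.
  by congr (_%:P); rewrite -natr1 natrM; field.
rewrite -den_L mulrC /Q -/L -comp_polyM P_rec // /Pnum comp_polyB !comp_polyZ.
congr (_ *: _ - _); rewrite rmorph_prod; apply: eq_bigr => i _ /=.
rewrite comp_polyD -/(Pden k) den_L comp_polyC /a /ell -addrA; congr (_ + _).
by rewrite -polyC1 -polyCN -polyCD; congr (_%:P); rewrite natrD; ring.
Qed.

Lemma Q_cone k : (1 <= k)%N -> cone k (Q k).
Proof.
case: k => // k _; elim: k => [|k IHk].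
  have -> : Q 1 = E 1 0 by rewrite /Q /E P_1 big_geq // comp_polyC.
  exact: cone_gen.
have [q q_cone q_eq] := step_cone IHk.
suff -> : Q k.+2 = q by [].
have ell_neq0 : ell != 0.
  apply/eqP => /(congr1 (fun p : {poly rat} => p.[0])).
  by rewrite /ell !hornerE.
by apply: (mulfI ell_neq0); rewrite q_eq Q_rec.
Qed.

Theorem corollary2 (k : nat) (hk : (1 <= k)%N) :
  let Q : {poly rat} := P k \Po ('X + (k%:R - 3%:R / 2%:R)%:P) in
  forall m : nat, (m <= (size Q).-1)%N -> 0 < Q`_m.
Proof.
move=> Qk m le_m; have [Q_neq0 Q_gt0] := cone_pos (Q_cone hk).
by apply: Q_gt0; rewrite -(prednK (n := size (Q k))) ?size_poly_gt0.
Qed.
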